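(* Let $n\ge 1$, let $1\le k\le n$, and let $\tau\in\{0,1\}^n$ be a word with exactly $k$ letters equal to $1$. Let $\lambda(\tau)=(\lambda_1,\ldots,\lambda_k)$ be the partition associated to $\tau$, and set $\lambda_{k+1}=0$. Define $P(\tau)=\sum_T \mathrm{wt}(T)$, where the sum is over all Catalan tableaux $T$ of type $\tau$. Then \[ P(\tau)=\alpha^{k+\lambda_1}\beta^n\det A^{\alpha,\beta}_{\lambda(\tau)}, \] where $A^{\alpha,\beta}_{\lambda(\tau)}=(A_{ij})_{1\le i,j\le k}$ is the $k\times k$ matrix with entries \[ A_{ij}=\left(\binom{\lambda_{j+1}}{j-i+1}+\frac{1}{\beta}\binom{\lambda_{j+1}}{j-i}\right)+\sum_{p=1}^{\lambda_j-\lambda_{j+1}}\left(\frac{1}{\alpha}\right)^p\left(\binom{\lambda_{j+1}+p-1}{j-i}+\frac{1}{\beta}\binom{\lambda_{j+1}+p-1}{j-i-1}\right). \]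
   Context: $\alpha,\beta$ are indeterminates (or nonzero reals). Binomial coefficients satisfy $\binom{m}{r}=0$ if $r<0$ or $r>m$, and $\binom{m}{0}=1$; an empty sum is $0$. Partition of a word: for $\tau\in\{0,1\}^n$ with $k$ ones, $\lambda(\tau)=(\lambda_1,\ldots,\lambda_k)$ where $\lambda_i$ is the total number of $0$'s occurring (anywhere) after the $i$-th $1$ of $\tau$; thus $n-k\ge\lambda_1\ge\cdots\ge\lambda_k\ge 0$. Catalan tableau: a Catalan (alternative) tableau of size $(n,k)$ is a Young diagram $Y$ contained in a $k\times(n-k)$ rectangle (k rows, $n-k$ columns), justified to the northwest (row $i$, counted from the top, consists of the leftmost $\lambda_i$ boxes of that row of the rectangle, with $\lambda_1\ge\cdots\ge\lambda_k\ge0$), together with a filling of the boxes of $Y$ with symbols $\alpha$ and $\beta$ (each box containing at most one symbol) such that: (i) every box of $Y$ in the same column and above a box containing $\alpha$ is empty; (ii) every box of $Y$ in the same row and to the left of a box containing $\beta$ is empty; (iii) every box of $Y$ that is neither above an $\alpha$ (in its column) nor to the left of a $\beta$ (in its row) contains an $\alpha$ or a $\beta$. The type of the tableau is the word in $\{0,1\}^n$ obtained by walking along the southeast border of $Y$ from the northeast corner to the southwest corner of the rectangle, writing $1$ for each south step and $0$ for each west step; equivalently, a Catalan tableau of type $\tau$ is one whose Young diagram has row lengths $\lambda(\tau)$ inside the $k\times(n-k)$ rectangle. Weight: an $\alpha$-free column is a column of the $k\times(n-k)$ rectangle containing no $\alpha$; a $\beta$-free row is a row of the rectangle containing no $\beta$.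 The weight of a Catalan tableau $T$ of size $(n,k)$ is $\mathrm{wt}(T)=(\alpha\beta)^n(1/\alpha)^{f_{\mathrm{col}}(T)}(1/\beta)^{f_{\mathrm{row}}(T)}$, where $f_{\mathrm{col}}(T)$ is the number of $\alpha$-free columns and $f_{\mathrm{row}}(T)$ the number of $\beta$-free rows. *)

(* Defs.v *)
From mathcomp Require Import all_boot all_order all_algebra.
Set Implicit Arguments. Unset Strict Implicit. Unset Printing Implicit Defensive.
Import Order.TTheory GRing.Theory Num.Theory.

Fixpoint lamseq (s : seq bool) : seq nat :=
  match s with
  | [::] => [::]
  | true :: s' => count negb s' :: lamseq s'
  | false :: s' => lamseq s'
  end.

(* lam tau i = lambda_{i+1} (0-indexed); equals 0 for i >= k (so lambda_{k+1} = 0). *)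
Definition lam (tau : seq bool) (i : nat) : nat := nth 0 (lamseq tau) i.

Definition inY (tau : seq bool) (i j : nat) : bool := j < lam tau i.

(* Fillings of the k x (n-k) rectangle: None = empty, Some true = alpha,
   Some false = beta. *)
Definition filling (n k : nat) := {ffun 'I_k * 'I_(n - k) -> option bool}.

Definition isA (x : option bool) : bool := x == Some true.
Definition isB (x : option bool) : bool := x == Some false.

Definition catalan (n k : nat) (tau : seq bool) (f : filling n k) : bool :=
  [&& [forall i : 'I_k, forall j : 'I_(n - k), ~~ inY tau i j ==> (f (i, j) == None)],
      [forall i : 'I_k, forall j : 'I_(n - k), forall i' : 'I_k,
         [&& inY tau i j, inY tau i' j, (i' < i)%N & isA (f (i, j))] ==>
         (f (i', j) == None)],
      [forall i : 'I_k, forall j : 'I_(n - k), forall j' : 'I_(n - k),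
         [&& inY tau i j, inY tau i j', (j' < j)%N & isB (f (i, j))] ==>
         (f (i, j') == None)] &
      [forall i : 'I_k, forall j : 'I_(n - k),
         [&& inY tau i j,
             ~~ [exists i' : 'I_k, [&& inY tau i' j, (i < i')%N & isA (f (i', j))]] &
             ~~ [exists j' : 'I_(n - k), [&& inY tau i j', (j < j')%N & isB (f (i, j'))]]]
         ==> (f (i, j) != None)]].

Definition fcol (n k : nat) (f : filling n k) : nat :=
  #|[set j : 'I_(n - k) | [forall i : 'I_k, ~~ isA (f (i, j))]]|.
Definition frow (n k : nat) (f : filling n k) : nat :=
  #|[set i : 'I_k | [forall j : 'I_(n - k), ~~ isB (f (i, j))]]|.

Local Open Scope ring_scope.

Definition wt (R : fieldType) (a b : R) (n k : nat) (f : filling n k) : R :=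
  (a * b) ^+ n * (a ^- fcol f) * (b ^- frow f).

Definition Ptau (R : fieldType) (a b : R) (n k : nat) (tau : seq bool) : R :=
  \sum_(f : filling n k | catalan tau f) wt a b f.

Definition binz (m : nat) (r : int) : nat :=
  match r with
  | Posz r' => 'C(m, r')
  | Negz _ => 0%N
  end.

(* entry A_{ij} with 0-indexed i0 = i-1, j0 = j-1 *)
Definition Aent (R : fieldType) (a b : R) (tau : seq bool) (i0 j0 : nat) : R :=
  let l1 := lam tau j0.+1 in
  let l0 := lam tau j0 in
  let d : int := (Posz j0 - Posz i0)%R in
  (binz l1 (d + 1))%:R + b^-1 * (binz l1 d)%:R
  + \sum_(1 <= p < (l0 - l1).+1)
      a ^- p * ((binz (l1 + p - 1) d)%:R + b^-1 * (binz (l1 + p - 1) (d - 1))%:R).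

Definition Amat (R : fieldType) (a b : R) (k : nat) (tau : seq bool) : 'M[R]_k :=
  \matrix_(i < k, j < k) Aent a b tau i j.

(* Main.v *)
Require Import Defs.
From mathcomp Require Import all_boot all_order all_algebra.
From mathcomp Require Import zify ring.
Import GRing.Theory.
Set Implicit Arguments.
Unset Strict Implicit.
Unset Printing Implicit Defensive.
Local Open Scope ring_scope.

(** Let Q(lambda) be the sum of [a ^ #alpha * b ^ #beta] over the tableaux of
    shape lambda. A column of a tableau holds at most one alpha and a row at
    most one beta, so P(tau) = a^k b^(n-k) Q(lambda(tau)). A corner box is never
    forced to be empty; an alpha in it empties its column and a beta empties its
    row, so Q(lambda) = a Q(lambda minus the column) + b Q(lambda minus the row).
    For the corner of the bottom row this says that the determinants satisfy
    D(lambda_1, ..., lambda_k) =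
      D(lambda_1 - 1, ..., lambda_k - 1) + D(lambda_1, ..., lambda_(k-1)).
    The matrix is upper Hessenberg with ones below the diagonal. By Pascal's
    rule, multiplication by a unipotent bidiagonal matrix turns all columns of
    the matrix of lambda - 1 but the last into those of lambda; a summation by
    parts evaluates the difference of the last columns. *)

(** * Tableaux for an arbitrary blocking relation *)

Section Tableaux.

Variables (T : finType) (blocks : bool -> rel T).
Implicit Types (Y : {set T}) (f g : {ffun T -> option bool}).

(* [blocks s q p]: the symbol [s] in cell [p] forces cell [q] to be empty. *)
Definition tableau Y f : bool :=
  [&& [forall q, (q \in Y) || (f q == None)],
      [forall s, forall q, forall p,
         blocks s q p && (f p == Some s) ==> (f q == None)] &
      [forall q, (q \in Y) && (f q == None) ==>
         [exists s, exists p, blocks s q p && (f p == Some s)]]].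

Lemma tableauP Y f :
  reflect [/\ forall q, q \notin Y -> f q = None,
              forall s q p, blocks s q p -> f p = Some s -> f q = None &
              forall q, q \in Y -> f q = None ->
                exists s p, blocks s q p /\ f p = Some s]
          (tableau Y f).
Proof.
apply: (iffP and3P) => [[/forallP h0 /forallP h1 /forallP h2]|[h0 h1 h2]]; split.
- by move=> q qY; have := h0 q; rewrite (negbTE qY) => /eqP.
- move=> s q p bqp fp; apply/eqP; move/forallP/(_ q)/forallP/(_ p): (h1 s).
  by rewrite bqp fp eqxx.
- move=> q qY fq; have := h2 q; rewrite qY fq /= => /existsP[s /existsP[p]].
  by case/andP=> bqp /eqP fp; exists s, p.
- apply/forallP=> q; case: (boolP (q \in Y)) => //= qY; exact/eqP/h0.
- apply/forallP=> s; apply/forallP=> q; apply/forallP=> p.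
  by apply/implyP=> /andP[bqp /eqP fp]; apply/eqP; apply: h1 bqp fp.
- apply/forallP=> q; apply/implyP=> /andP[qY /eqP fq].
  have [s [p [bqp fp]]] := h2 q qY fq.
  by apply/existsP; exists s; apply/existsP; exists p; rewrite bqp fp eqxx.
Qed.

Definition upd f (p : T) x : {ffun T -> option bool} :=
  [ffun q => if q == p then x else f q].

Lemma updE f p x q : upd f p x q = if q == p then x else f q.
Proof. by rewrite ffunE. Qed.

Definition del Y (p : T) (s : bool) : {set T} :=
  [set q in Y | (q != p) && ~~ blocks s q p].

Section Corner.

Variables (Y : {set T}) (p0 : T) (s0 : bool).
Hypothesis blocks_irr : forall s q, ~~ blocks s q q.
Hypothesis p0Y : p0 \in Y.
Hypothesis p0_corner : forall s p, p \in Y -> ~~ blocks s p0 p.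

(** Cells blocked by the symbol in [p0] are empty anyway, so they may leave the shape together with
    [p0]; no cell of [Y] blocks [p0], so a symbol there is always allowed. *)
Lemma tableau_upd g :
  tableau Y (upd g p0 (Some s0)) && (g p0 == None) = tableau (del Y p0 s0) g.
Proof.
apply/andP/tableauP => [[/tableauP[h0 h1 h2] /eqP g0]|[h0 h1 h2]].
  have gS p s : g p = Some s -> upd g p0 (Some s0) p = Some s.
    by rewrite updE; case: eqP => // ->; rewrite g0.
  have gN p : upd g p0 (Some s0) p = None -> g p = None.
    by rewrite updE; case: eqP.
  have u0 : upd g p0 (Some s0) p0 = Some s0 by rewrite updE eqxx.
  split=> [q|s q p bqp /gS gp|q].
  - rewrite inE !negb_and !negbK; case/or3P=> [/h0/gN //|/eqP->//|bq].
    exact/gN/(h1 _ _ _ bq u0).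
  - exact/gN/(h1 _ _ _ bqp gp).
  - rewrite inE => /and3P[qY qp0 nb] gq.
    have [|s [p [bqp]]] := h2 q qY; first by rewrite updE (negbTE qp0).
    rewrite updE; case: eqP => [pE [sE]|_ gp]; last by exists s, p.
    by case/negP: nb; rewrite sE -pE.
have g0 : g p0 = None by apply: h0; rewrite inE eqxx andbF.
have gY p s : g p = Some s -> p \in Y.
  move=> gp; have : p \in del Y p0 s0.
    by apply/negPn/negP=> /h0; rewrite gp.
  by rewrite inE => /andP[].
split; last by apply/eqP.
apply/tableauP; split=> [q qY|s q p bqp|q qY].
- rewrite updE; case: eqP => [qE|_]; first by rewrite qE p0Y in qY.
  by apply: h0; rewrite inE (negbTE qY).
- rewrite !updE; case: eqP => [pE [sE]|_ gp].
    case: eqP => [qE|_]; first by move: bqp; rewrite pE qE (negbTE (blocks_irr _ _)).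
    by apply: h0; rewrite inE sE -pE bqp !andbF.
  case: eqP => [qE|_]; last exact: h1 bqp gp.
  by move: bqp; rewrite qE (negbTE (p0_corner _ (gY _ _ gp))).
- rewrite updE; case: eqP => // /eqP qp0 gq.
  case: (boolP (blocks s0 q p0)) => bq.
    by exists s0, p0; rewrite updE eqxx.
  have [|s [p [bqp gp]]] := h2 q _ gq; first by rewrite inE qY qp0.
  exists s, p; split=> //; rewrite updE; case: eqP => // pE.
  by rewrite pE g0 in gp.
Qed.

End Corner.

Variables (R : comNzRingType) (w : bool -> R).

Definition cellw (x : option bool) : R := if x is Some s then w s else 1.
Definition fillw f : R := \prod_p cellw (f p).
Definition tabsum Y : R := \sum_(f | tableau Y f) fillw f.

(** No cell of [Y] blocks [p0], so [p0] cannot be empty and the sum splits by its symbol. *)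
Lemma tabsum_corner Y p0 :
  (forall s q, ~~ blocks s q q) -> p0 \in Y ->
  (forall s p, p \in Y -> ~~ blocks s p0 p) ->
  tabsum Y = w true * tabsum (del Y p0 true) + w false * tabsum (del Y p0 false).
Proof.
move=> irr p0Y corner.
have part s : \sum_(f | tableau Y f && (f p0 == Some s)) fillw f
    = w s * tabsum (del Y p0 s).
  (* Emptying [p0] and writing [s] back are mutually inverse. *)
  rewrite (reindex_onto (fun g => upd g p0 (Some s)) (fun f => upd f p0 None)) /=.
    rewrite /tabsum mulr_sumr; apply: eq_big => [g|g].
      rewrite -tableau_upd // updE !eqxx andbT; congr andb.
      apply/eqP/eqP=> [<-|g0]; first by rewrite updE eqxx.
      by apply/ffunP=> q; rewrite !updE; case: eqP => // ->.
    case/andP=> _ /eqP gE.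
    have g0 : g p0 = None by rewrite -gE updE eqxx.
    rewrite /fillw (bigD1 p0) //= [in RHS](bigD1 p0) //= updE eqxx g0 mul1r.
    by congr (_ * _); apply: eq_bigr => q qp0; rewrite updE (negbTE qp0).
  move=> f /andP[_ /eqP fp0]; apply/ffunP=> q; rewrite !updE.
  by case: eqP => // ->.
rewrite /tabsum (bigID (fun f => f p0 == Some true)) /= -part; congr (_ + _).
rewrite -part; apply: eq_bigl => f; case: (boolP (tableau Y f)) => //= Tf.
have [h0 _ h] := tableauP _ _ Tf.
case fp0: (f p0) => [[]|] //.
have [s [p [bqp fp]]] := h p0 p0Y fp0.
case: (boolP (p \in Y)) => pY; first by move: bqp; rewrite (negbTE (corner _ _ pY)).
by rewrite h0 in fp.
Qed.

End Tableaux.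


(** * Determinants of unit upper Hessenberg matrices *)

Section Hessenberg.

Variable R : comNzRingType.
Implicit Types (c : nat -> nat -> R) (u v : nat -> R).

(* [hess c k v] is the determinant of the k x k matrix whose last column is [v]
   and whose other columns are [c 0, ..., c (k - 2)], when the subdiagonal
   entries [c j j.+1] are 1 and everything below them is 0. *)
Fixpoint hess c k : (nat -> R) -> R :=
  if k is k'.+1 then fun v =>
    v k' * (if k' is k''.+1 then hess c k' (c k'') else 1) - hess c k' v
  else fun=> 0.

(** The leading principal minor of order [k] of the columns [c]. *)
Definition hminor c k : R := if k is k'.+1 then hess c k (c k') else 1.

(** Expansion along the last row, which ends in 1 and [v k]. The value 0 of [hess] at order 0 makes
    this include the 1 x 1 case. *)
Lemma hessS c k v : hess c k.+1 v = v k * hminor c k - hess c k v.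
Proof. by case: k. Qed.

Lemma eq_hess c c' k u v :
    (forall j i, (j.+1 < k)%N -> c j i = c' j i) ->
    (forall i, (i < k)%N -> u i = v i) ->
  hess c k u = hess c' k v.
Proof.
elim: k u v => // k IH u v ec euv; rewrite !hessS euv // (IH u v); first last.
- by move=> i ik; apply: euv; lia.
- by move=> j i jk; apply: ec; lia.
congr (_ * _ - _); case: k IH ec euv => // k IH ec euv; apply: IH => [j i jk|i ik];
  by apply: ec; lia.
Qed.

Lemma hess_linear c k x u v :
  hess c k (fun i => x * u i + v i) = x * hess c k u + hess c k v.
Proof.
elim: k => [|k IH]; first by rewrite /= mulr0 addr0.
by rewrite !hessS IH; ring.
Qed.

Lemma hess_eq0 c k v : (forall i, (i < k)%N -> v i = 0) -> hess c k v = 0.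
Proof.
elim: k => // k IH v0; rewrite hessS v0 // mul0r IH ?subr0 // => i ik.
by apply: v0; lia.
Qed.

(* Multiplication by the unipotent bidiagonal matrix, up to the entry that the
   truncation to k + 1 rows loses in the last column. *)
Lemma hess_shift c c' k v :
    (forall j i, (j < k)%N -> c j i = c' j i + c' j i.+1) ->
    (forall j, (j < k)%N -> c' j j.+1 = 1) ->
  hess c k.+1 (fun i => v i + v i.+1) = hess c' k.+1 v + v k.+1 * hminor c k.
Proof.
elim: k v => [|k IH] v cc' c1; first by rewrite /=; ring.
have {}IH u : hess c k.+1 (fun i => u i + u i.+1) =
    hess c' k.+1 u + u k.+1 * hminor c k.
  by apply: IH => [j i jk|j jk]; [apply: cc'|apply: c1]; lia.
(* The induction hypothesis at [u := c' k], whose shifted sum is the column [c k]. *)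
have minE : hminor c k.+1 = hminor c' k.+1 + hminor c k.
  rewrite -[hminor c k]mul1r -(c1 k) // -IH /hminor.
  by apply: eq_hess => // i ik; apply: cc'.
by rewrite hessS IH [in RHS]hessS minE; ring.
Qed.

Lemma det_hess c k v :
    (forall i j, (j.+1 < i)%N -> c j i = 0) -> (forall j, c j j.+1 = 1) ->
  \det (\matrix_(i < k.+1, j < k.+1) (if (j < k)%N then c j i else v i)) =
  hess c k.+1 v.
Proof.
move=> c0 c1; elim: k v => [|k IH] v.
  by rewrite det_mx11 mxE /=; ring.
pose M := \matrix_(i < k.+2, j < k.+2) (if (j < k.+1)%N then c j i else v i).
pose j0 : 'I_k.+2 := widen_ord (leqnSn k.+1) ord_max.
have j0max : j0 != ord_max by rewrite -val_eqE /=; lia.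
rewrite hessS -(IH v) -/M (expand_det_row M ord_max) (bigD1 ord_max) //= (bigD1 j0) //=.
rewrite big1 ?addr0 => [|j /andP[jmax jj0]]; last first.
  rewrite mxE ifT ?c0 ?mul0r //; have := ltn_ord j;
  by move: jmax jj0; rewrite -!val_eqE /=; lia.
rewrite !mxE /= ltnn ltnSn c1 mul1r /cofactor /=; congr (_ * _ + _).
  rewrite -signr_odd addnn odd_double mul1r -[RHS]/(hess c k.+1 (c k)) -IH.
  congr (\det _); apply/matrixP=> i j; rewrite !mxE !lift_max ltn_ord.
  by case: ltnP => // kj; congr (c _ _); have := ltn_ord j; lia.
rewrite -signr_odd addSn /= addnn odd_double /= mulN1r; congr (- \det _).
(* Deleting column [k] moves [v] from position [k.+1] to [k], so the minor has the same form. *)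
apply/matrixP=> i j; rewrite !mxE lift_max /= /bump.
by case: (ltnP j k) => jk /=; [rewrite ifT|rewrite ifF]; rewrite //; lia.
Qed.

End Hessenberg.

(** * Columns of the matrix and recursion for its determinant *)

Section Columns.

Variables (R : fieldType) (a b : R).

(** Every bracket of [Aent] has this form: the first with index [j.+1], those under the sum with
    index [j]. *)
Definition binw (j m i : nat) : R :=
  (binz m (Posz j - Posz i))%:R + b^-1 * (binz m (Posz j - Posz i - 1))%:R.

(** Column [j] for consecutive parts [l0], [l1], defined at every row [i] since shifting reads one
    row below the matrix. *)
Definition col (l0 l1 j i : nat) : R :=
  binw j.+1 l1 i + \sum_(p < l0 - l1) a ^- p.+1 * binw j (l1 + p) i.

Lemma binz_pascal m (r : int) : binz m.+1 r = (binz m r + binz m (r - 1))%N.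
Proof.
case: r => [[|r]|r]; rewrite /= ?bin0 //.
by rewrite binS subn1.
Qed.

Lemma binw_shift j m i : binw j.+1 m i.+1 = binw j m i.
Proof.
by rewrite /binw; have -> : (Posz j.+1 - Posz i.+1 = Posz j - Posz i)%R by lia.
Qed.

Lemma binw_pascal j m i : binw j m.+1 i = binw j m i + binw j m i.+1.
Proof.
rewrite /binw !binz_pascal !natrD.
have -> : (Posz j - Posz i.+1 = Posz j - Posz i - 1)%R by lia.
by ring.
Qed.

Lemma binw_gt j m i : (j < i)%N -> binw j m i = 0.
Proof.
move=> ji; rewrite /binw.
have -> : (Posz j - Posz i = Negz (i - j).-1)%R by lia.
have -> : (Negz (i - j).-1 - 1 = Negz (i - j))%R by lia.
by rewrite /= mulr0 addr0.
Qed.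

Lemma binw_diag j m : binw j m j = 1.
Proof. by rewrite /binw subrr /= bin0 mulr0 addr0. Qed.

Lemma col_gt l0 l1 j i : (j.+1 < i)%N -> col l0 l1 j i = 0.
Proof.
move=> ji; rewrite /col binw_gt // add0r big1 // => p _.
by rewrite binw_gt ?mulr0 //; lia.
Qed.

Lemma col_diag l0 l1 j : col l0 l1 j j.+1 = 1.
Proof.
rewrite /col binw_diag big1 ?addr0 // => p _.
by rewrite binw_gt ?mulr0 //; lia.
Qed.

(** Lowering both parts by 1 keeps the number of summands, so Pascal's rule applies term by term. *)
Lemma col_pascal l0 l1 j i :
  col l0.+1 l1.+1 j i = col l0 l1 j i + col l0 l1 j i.+1.
Proof.
rewrite /col subSS binw_pascal [RHS]addrACA -big_split /=; congr (_ + _).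
by apply: eq_bigr => p _; rewrite -mulrDr addSn binw_pascal.
Qed.

Lemma colS l j i : col l.+1 0 j i = col l 0 j i + a ^- l.+1 * binw j l i.
Proof. by rewrite /col !subn0 big_ord_recr /= addrA. Qed.

Lemma col_split l m j i : (l <= m)%N ->
  col m 0 j i = col l 0 j i + a ^- l * (col m l j i - binw j.+1 l i).
Proof.
move=> /subnKC <-; set d := (m - l)%N.
rewrite /col !subn0 addKn big_split_ord /= addrA.
congr (_ + _); rewrite [X in _ * X]addrC addKr mulr_sumr; apply: eq_bigr => p _.
by rewrite mulrA -invfM -exprD addnS.
Qed.

(* Summation by parts. *)
Lemma col_step l j i :
  col l.+1 0 j.+1 i - (col l 0 j.+1 i + col l 0 j.+1 i.+1) =
  a ^- l.+1 * binw j.+1 l.+1 i - col l.+1 0 j i.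
Proof.
elim: l => [|l IH].
  rewrite !colS /col !big_ord0 !addr0 !binw_shift binw_pascal binw_shift.
  by rewrite expr1; ring.
rewrite (colS l.+1 j.+1) {1}(canRL (subrK _) IH) !(colS l j.+1) (colS l.+1 j).
rewrite (binw_pascal j.+1 l.+1 i) (binw_shift j l.+1) (binw_pascal j.+1 l i); ring.
Qed.

Definition cols (mu : nat -> nat) (j : nat) : nat -> R := col (mu j) (mu j.+1) j.

(** The last column takes 0 as the next part, so only the first [r] parts of [mu] enter. *)
Definition hdet (r : nat) (mu : nat -> nat) : R :=
  if r is r'.+1 then hess (cols mu) r (col (mu r') 0 r') else 1.

(** The last column vanishes above its bottom entry [b^-1]. *)
Lemma hdet_zero r mu : mu r = 0%N -> hdet r.+1 mu = b^-1 * hdet r mu.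
Proof.
move=> mur; rewrite /hdet hessS mur.
have colE i : col 0 0 r i = binw r.+1 0 i by rewrite /col big_ord0 addr0.
rewrite hess_eq0 ?subr0 => [|i ir]; last first.
  rewrite colE /binw.
  have -> : (Posz r.+1 - Posz i = Posz (r - i.+1).+2)%R by lia.
  have -> : (Posz (r - i.+1).+2 - 1 = Posz (r - i.+1).+1)%R by lia.
  by rewrite /= mulr0 addr0.
have -> : col 0 0 r r = b^-1.
  rewrite colE /binw.
  have -> : (Posz r.+1 - Posz r = 1)%R by lia.
  by rewrite subrr /= mulr1 add0r.
(* As [mu r] is 0, the leading minor already ends in the last column of [hdet r mu]. *)
by case: r mur {colE} => //= r; rewrite /cols => ->.
Qed.

Lemma hdet1 mu : hdet 1 mu = b^-1 + \sum_(p < mu 0) a ^- p.+1.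
Proof.
rewrite /= mulr1 subr0 /col subn0; congr (_ + _).
  by rewrite /binw /= mulr1 add0r.
by apply: eq_bigr => p _; rewrite binw_diag mulr1.
Qed.

Lemma hdet_step r mu nu :
    (forall i, (i <= r.+1)%N -> mu i = (nu i).+1) -> (mu r.+1 <= mu r)%N ->
  hdet r.+2 mu = hdet r.+2 nu + hdet r.+1 mu.
Proof.
move=> mn mur; rewrite /hdet.
set l := nu r.+1; have muE : mu r.+1 = l.+1 by rewrite mn.
have shift : hess (cols mu) r.+2 (fun i => col l 0 r.+1 i + col l 0 r.+1 i.+1) =
    hess (cols nu) r.+2 (col l 0 r.+1) + hminor (cols mu) r.+1.
  rewrite (@hess_shift _ (cols mu) (cols nu)) ?col_diag ?mul1r // => j.
    by move=> i jr; rewrite /cols !mn ?col_pascal //; lia.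
  by move=> jr; rewrite /cols col_diag.
rewrite muE.
(* [col_step] brings in [col l.+1 0 r], which [col_split] trades for two columns starting at [mu r];
   the [binw] terms cancel. *)
rewrite (@eq_hess _ (cols mu) (cols mu) r.+2 (col l.+1 0 r.+1) (fun i =>
   -1 * col (mu r) 0 r i + (a ^- l.+1 * cols mu r i +
      (col l 0 r.+1 i + col l 0 r.+1 i.+1)))) //; last first.
  move=> i _; rewrite /cols muE (@col_split l.+1 (mu r)) -?muE // muE.
  by apply: (addIr (- (col l 0 r.+1 i + col l 0 r.+1 i.+1))); rewrite col_step; ring.
(* The term in [cols mu r] repeats the preceding column and vanishes. The one in [col (mu r) 0 r]
   gives [hdet r.+1 mu] minus the leading minor, which cancels the surplus in [shift]. *)
rewrite !hess_linear shift (hessS _ r.+1 (col (mu r) 0 r)) (hessS _ r.+1 (cols mu r)).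
have -> : cols mu r r.+1 = 1 by exact: col_diag.
rewrite col_diag -[hess _ r.+1 (cols mu r)]/(hminor (cols mu) r.+1).
by ring.
Qed.

(** The closed form expected for Q. Without rows [mu 0] is not a part, hence the separate value
    1. *)
Definition shapew (r : nat) (mu : nat -> nat) : R :=
  if r is 0 then 1 else a ^+ mu 0 * b ^+ r * hdet r mu.

Hypothesis a0 : a != 0.
Hypothesis b0 : b != 0.

Lemma shapew_zero r mu : mu r = 0%N -> shapew r.+1 mu = shapew r mu.
Proof.
move=> mur; rewrite /shapew hdet_zero //; case: r mur => [->|r _].
  by rewrite /= expr0 expr1 mulr1 mul1r mulfV.
by rewrite exprS; field.
Qed.

Lemma shapew_step r mu nu :
    (forall i, (i <= r)%N -> mu i = (nu i).+1) -> (mu r <= mu r.-1)%N ->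
  shapew r.+1 mu = a * shapew r.+1 nu + b * shapew r mu.
Proof.
case: r => [|r] mn mur; rewrite /shapew.
  (* In a single row the last summand cancels against the power of [a] and leaves [b]. *)
  rewrite !hdet1 mn // big_ord_recr /= !expr1 exprS; field.
  by rewrite a0 b0 expf_neq0.
by rewrite (@hdet_step r mu nu) // mn // !exprS; ring.
Qed.

End Columns.

(** * Tableaux of Young shapes *)

Section Shapes.

Variables (k m : nat) (l : nat -> nat).
Hypothesis l_anti : forall i j, (i <= j)%N -> (l j <= l i)%N.

Definition young_blocks (s : bool) (q p : 'I_k * 'I_m) : bool :=
  if s then (q.2 == p.2) && (q.1 < p.1)%N else (q.1 == p.1) && (q.2 < p.2)%N.

(* Keeping the set [C] of surviving columns avoids renumbering after a deletion. *)
Definition shape (r : nat) (C : {set 'I_m}) : {set 'I_k * 'I_m} :=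
  [set p : 'I_k * 'I_m | [&& (p.1 < r)%N, p.2 \in C & (p.2 < l p.1)%N]].

Definition rowlen (C : {set 'I_m}) (i : nat) : nat :=
  #|[set j in C | (j < l i)%N]|.

Lemma young_blocks_irr s q : ~~ young_blocks s q q.
Proof. by rewrite /young_blocks; case: s; rewrite ltnn andbF. Qed.

Lemma shape_rowlen0 r C : rowlen C r = 0%N -> shape r.+1 C = shape r C.
Proof.
move/eqP; rewrite cards_eq0 => /eqP C0; apply/setP=> -[i j]; rewrite !inE /=.
rewrite ltnS leq_eqVlt; case: eqVneq => //= ->.
by have := in_set0 j; rewrite -C0 inE ltnn => ->.
Qed.

Lemma rowlen_anti C i j : (i <= j)%N -> (rowlen C j <= rowlen C i)%N.
Proof.
move=> ij; apply/subset_leq_card/subsetP=> x; rewrite !inE => /andP[-> /= xj].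
exact: leq_trans xj (l_anti ij).
Qed.

Lemma rowlenD1 (C : {set 'I_m}) (j : 'I_m) i :
  j \in C -> (j < l i)%N -> rowlen C i = (rowlen (C :\ j) i).+1.
Proof.
move=> jC ji; rewrite /rowlen (cardsD1 j) !inE jC ji add1n; congr _.+1.
by apply: eq_card => x; rewrite !inE andbA.
Qed.

Variables (R : fieldType) (a b : R).
Hypothesis a0 : a != 0.
Hypothesis b0 : b != 0.

Lemma tabsum_shape r C : (r <= k)%N ->
  tabsum young_blocks (fun s => if s then a else b) (shape r C) =
  shapew a b r (rowlen C).
Proof.
(* An alpha in the corner deletes a column, a beta deletes a row. *)
have [N] := ubnP (r + #|C|); elim: N r C => // N IH [|r] C /ltnSE leN rk.
  have -> : shape 0 C = set0 by apply/setP=> p; rewrite !inE.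
  rewrite /tabsum (big_pred1 [ffun=> None]) /fillw.
    by apply: big1 => p _; rewrite ffunE.
  move=> f /=; apply/tableauP/eqP => [[h _ _]|->].
    by apply/ffunP=> p; rewrite ffunE h ?inE.
  by split=> [q _|s q p _|q]; rewrite ?ffunE ?inE.
have [r0|] := posnP (rowlen C r).
  by rewrite shape_rowlen0 // shapew_zero // IH //; lia.
rewrite card_gt0 => /set0Pn[j1 j1P].
(* The rightmost surviving box of the bottom row is a corner. *)
have [j0] : exists j0 : 'I_m, [/\ j0 \in C, (j0 < l r)%N &
    forall j, j \in C -> (j < l r)%N -> (j <= j0)%N].
  case: (@arg_maxnP _ j1 (mem [set j in C | (j < l r)%N]) (@nat_of_ord m) j1P) => j0.
  rewrite /= inE => /andP[jC jr] jmax; exists j0; split=> // j jC' jr'.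
  by apply: jmax; rewrite /= inE jC' jr'.
case=> jC jr jmax.
pose p0 : 'I_k * 'I_m := (Ordinal rk, j0).
(* Higher rows are at least as long, so deleting column [j0] shortens every row by one. *)
have li i : (i <= r)%N -> (j0 < l i)%N by move=> /l_anti; apply: leq_trans.
rewrite (@tabsum_corner _ _ _ _ _ p0) //; first last.
- case=> -[i j]; rewrite inE /= => /and3P[ir jC' jl];
    rewrite /young_blocks negb_and -leqNgt /=.
    by rewrite orbC -ltnS ir.
  by case: eqVneq => //= ri; apply: jmax => //; rewrite -ri in jl.
- by rewrite inE /= ltnSn jC jr.
- exact: young_blocks_irr.
rewrite (@shapew_step _ _ _ a0 b0 r (rowlen C) (rowlen (C :\ j0))); first last.
- by apply: rowlen_anti; lia.
- by move=> i ir; apply: rowlenD1 => //; apply: li.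
rewrite -IH //; last by rewrite (cardsD1 j0) jC add1n addnS in leN.
rewrite -IH; [|lia|lia].
(* Row [r] is the lowest, so the corner and the cells above it fill its column. *)
have -> : del young_blocks (shape r.+1 C) p0 true = shape r.+1 (C :\ j0).
  apply/setP=> -[i j]; rewrite !inE xpair_eqE /= negb_and.
  case: (eqVneq j j0) => [->|] /=; last by rewrite orbT !andbT.
  by rewrite orbF andbF -val_eqE /=; lia.
(* By maximality of [j0], the corner and the cells on its left exhaust the bottom row. *)
suff -> : del young_blocks (shape r.+1 C) p0 false = shape r C by [].
apply/setP=> -[i j]; rewrite !inE xpair_eqE /= -!val_eqE /=.
case: (ltngtP i r) => [ir|ir|ir] /=; first by rewrite !andbT ltnS ltnW.
  by rewrite ltnS leqNgt ir.
rewrite ir ltnSn /=.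
have := jmax j; case: (j \in C) => //= jm; case: (ltnP j (l r)) => // /(jm isT) jj0.
by lia.
Qed.

End Shapes.

(** * The partition of a word *)

Lemma size_lamseq tau : size (lamseq tau) = count id tau.
Proof. by elim: tau => // -[] s /= ->. Qed.

Lemma lam_le tau i : (lam tau i <= count negb tau)%N.
Proof.
rewrite /lam; elim: tau i => [|[] s IH] [|i] //=; rewrite ?add0n ?add1n //.
all: exact: leqW.
Qed.

Lemma lam_anti tau i j : (i <= j)%N -> (lam tau j <= lam tau i)%N.
Proof.
elim: tau i j => [|[] s IH] i j ij; first by rewrite /lam !nth_nil.
  case: i j ij => [|i] [|j] //= ij; [exact: lam_le|exact: IH].
exact: IH.
Qed.

Lemma card_set_ord_lt m d : (d <= m)%N -> #|[set j : 'I_m | (j < d)%N]| = d.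
Proof.
move=> dm; rewrite -sum1_card (eq_bigl (fun j : 'I_m => (j < d)%N)).
  by rewrite -(big_ord_widen m (fun=> 1%N) dm) sum1_card card_ord.
by move=> j; rewrite inE.
Qed.

(** * Catalan tableaux and their weights *)

Section Weights.

Variables (n k : nat) (tau : seq bool) (f : filling n k).

(** [catalan] restricts its conditions to boxes of the diagram, [tableau] does not; they agree
    because cells outside are empty. *)
Lemma catalan_tableau :
  catalan tau f = tableau (@young_blocks k (n - k)%N)
    (@shape k (n - k)%N (lam tau) k setT) f.
Proof.
have inS i j : ((i, j) \in @shape k (n - k)%N (lam tau) k setT) = inY tau i j.
  by rewrite !inE /= ltn_ord.
apply/and4P/tableauP.
  case=> /forallP h0 /forallP h1 /forallP h2 /forallP h3.
  have hN (i : 'I_k) (j : 'I_(n - k)) : ~~ inY tau i j -> f (i, j) = None.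
    by move=> nY; move/forallP/(_ j)/implyP/(_ nY)/eqP: (h0 i).
  have hY (i : 'I_k) (j : 'I_(n - k)) s : f (i, j) = Some s -> inY tau i j.
    by move=> fp; apply/negPn/negP=> /hN; rewrite fp.
  split=> [[i j]|s [i' j'] [i j] bl fp|[i j]].
  - by rewrite inS; apply: hN.
  - case: (boolP (inY tau i' j')) => [Y'|/hN //]; apply/eqP.
    case: s bl fp => /= /andP[/eqP eqv lt] fp; subst.
      move/forallP/(_ j)/forallP/(_ i')/implyP: (h1 i); apply.
      by rewrite (hY _ _ _ fp) Y' lt fp.
    move/forallP/(_ j)/forallP/(_ j')/implyP: (h2 i); apply.
    by rewrite (hY _ _ _ fp) Y' lt fp.
  - rewrite inS => Yij fij; move/forallP/(_ j): (h3 i); rewrite Yij fij eqxx /=.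
    rewrite implybF negb_and !negbK => /orP[]/existsP[x /and3P[_ lt /eqP fx]].
      by exists true, (x, j); rewrite /= eqxx lt fx.
    by exists false, (i, x); rewrite /= eqxx lt fx.
case=> h0 h1 h2; have hY (i : 'I_k) (j : 'I_(n - k)) s : f (i, j) = Some s -> inY tau i j.
  by move=> fp; apply/negPn/negP; rewrite -inS => /h0; rewrite fp.
split; apply/forallP=> i; apply/forallP=> j.
- by apply/implyP; rewrite -inS => /h0 ->.
- apply/forallP=> i'; apply/implyP=> /and4P[_ _ lt /eqP fp]; apply/eqP.
  by apply: (h1 true _ _ _ fp); rewrite /= eqxx.
- apply/forallP=> j'; apply/implyP=> /and4P[_ _ lt /eqP fp]; apply/eqP.
  by apply: (h1 false _ _ _ fp); rewrite /= eqxx.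
- apply/implyP=> /and3P[Yij nA nB]; apply/eqP=> fij.
  have [|s [[i' j'] [bl fp]]] := h2 (i, j) _ fij; first by rewrite inS.
  case: s bl fp => /= /andP[/eqP eqv lt] fp; subst.
    by case/existsP: nA; exists i'; rewrite (hY _ _ _ fp) lt fp.
  by case/existsP: nB; exists j'; rewrite (hY _ _ _ fp) lt fp.
Qed.

(** Of two alphas in a column, the lower would force the upper to be empty, so projection to columns
    is injective on alphas. *)
Lemma fcol_catalan : catalan tau f ->
  (#|[set p | f p == Some true]| + fcol f = n - k)%N.
Proof.
rewrite catalan_tableau => /tableauP[_ h1 _].
rewrite -[RHS]card_ord -(@card_in_imset _ _ snd) => [|[i j] [i' j']]; last first.
  rewrite !inE /= => /eqP fA /eqP fA' jj'; subst j'.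
  case: (ltngtP i i') => [ii'|ii'|/val_inj->//].
    by move: (h1 true (i, j) (i', j)); rewrite /= eqxx ii' fA => /(_ isT fA').
  by move: (h1 true (i', j) (i, j)); rewrite /= eqxx ii' fA' => /(_ isT fA).
rewrite -[RHS](cardsC (snd @: [set p | f p == Some true])); congr addn.
apply: eq_card => j; rewrite !inE; apply/forallP/negP => [jf /imsetP[[i j']]|nA i].
  by rewrite inE /= => fA jj'; subst j'; have := jf i; rewrite /isA fA.
by apply/negP=> fA; apply: nA; apply/imsetP; exists (i, j); rewrite ?inE.
Qed.

Lemma frow_catalan : catalan tau f ->
  (#|[set p | f p == Some false]| + frow f = k)%N.
Proof.
rewrite catalan_tableau => /tableauP[_ h1 _].
rewrite -[RHS]card_ord -(@card_in_imset _ _ fst) => [|[i j] [i' j']]; last first.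
  rewrite !inE /= => /eqP fB /eqP fB' ii'; subst i'.
  case: (ltngtP j j') => [jj'|jj'|/val_inj->//].
    by move: (h1 false (i, j) (i, j')); rewrite /= eqxx jj' fB => /(_ isT fB').
  by move: (h1 false (i, j') (i, j)); rewrite /= eqxx jj' fB' => /(_ isT fB).
rewrite -[RHS](cardsC (fst @: [set p | f p == Some false])); congr addn.
apply: eq_card => i; rewrite !inE; apply/forallP/negP => [jf /imsetP[[i' j]]|nB j].
  by rewrite inE /= => fB ii'; subst i'; have := jf j; rewrite /isB fB.
by apply/negP=> fB; apply: nB; apply/imsetP; exists (i, j); rewrite ?inE.
Qed.

(** By the two counts, [n - fcol f] is [k] plus the number of alphas, and [n - frow f] is [n - k]
    plus the number of betas. *)
Lemma wt_catalan (R : fieldType) (a b : R) :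
    a != 0 -> b != 0 -> (k <= n)%N -> catalan tau f ->
  wt a b f = a ^+ k * b ^+ (n - k) * fillw (fun s => if s then a else b) f.
Proof.
move=> a0 b0 kn cat_f; set w := fun s : bool => _.
have -> : fillw w f = a ^+ #|[set p | f p == Some true]| *
                      b ^+ #|[set p | f p == Some false]|.
  rewrite -!prodr_const big_mkcond [X in _ * X]big_mkcond -big_split /=.
  apply: eq_bigr => p _; rewrite !inE.
  by case: (f p) => [[]|] /=; rewrite ?mulr1 ?mul1r.
have [cA cB] := (fcol_catalan cat_f, frow_catalan cat_f).
have aE : a ^+ n = a ^+ k * a ^+ #|[set p | f p == Some true]| * a ^+ fcol f.
  by rewrite -!exprD -addnA cA subnKC.
have bE : b ^+ n = b ^+ (n - k) * b ^+ #|[set p | f p == Some false]| * b ^+ frow f.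
  by rewrite -!exprD -addnA cB subnK.
rewrite /wt exprMn aE bE.
by field; rewrite !expf_neq0.
Qed.

End Weights.

(** * The determinant formula *)

Lemma Aent_col (R : fieldType) (a b : R) tau i j :
  Aent a b tau i j = cols a b (lam tau) j i.
Proof.
rewrite /Aent /cols /col /binw big_add1 big_mkord; congr (_ + _ * _ + _).
- by have -> : (Posz j - Posz i + 1 = Posz j.+1 - Posz i)%R by lia.
- by have -> : (Posz j.+1 - Posz i - 1 = Posz j - Posz i)%R by lia.
- by apply: eq_bigr => p _; rewrite addnS subn1.
Qed.

Theorem theorem1 (R : fieldType) (a b : R) (n k : nat) (tau : seq bool) :
  a != 0 -> b != 0 ->
  (1 <= n)%N -> (1 <= k <= n)%N -> size tau = n -> count id tau = k ->
  Ptau a b n k tau = a ^+ (k + lam tau 0) * b ^+ n * \det (Amat a b k tau).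
Proof.
move=> a0 b0 n0 /andP[k0 kn] sz cnt.
have cntN : count negb tau = (n - k)%N 
  by rewrite -sz -cnt -(count_predC id tau) addKn.
(* The default 0 of [nth] makes the last column of [Amat] the one used in [hdet]. *)
have lamk : lam tau k = 0%N by rewrite /lam nth_default // size_lamseq cnt.
have rl i : rowlen (lam tau) [set: 'I_(n - k)] i = lam tau i.
  rewrite /rowlen -[RHS](@card_set_ord_lt (n - k)) -?cntN ?lam_le //.
  by apply: eq_card => j; rewrite !inE.
have shapeE : shapew a b k (rowlen (lam tau) [set: 'I_(n - k)]) =
    a ^+ lam tau 0 * b ^+ k * \det (Amat a b k tau).
  clear - k0 lamk rl; move: (rowlen _ _) rl => mu rl {n}.
  case: k k0 lamk => // k _ lamk; rewrite /shapew rl /hdet -det_hess; first last.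
  - by move=> j; apply: col_diag.
  - by move=> i j; apply: col_gt.
  congr (_ * \det _); apply/matrixP=> i j; rewrite !mxE Aent_col /cols !rl.
  case: ltnP => // kj; have -> : (j : nat) = k by have := ltn_ord j; lia.
  by rewrite lamk.
have := tabsum_shape (lam_anti tau) a0 b0 [set: 'I_(n - k)] (leqnn k).
rewrite shapeE /tabsum => tabE; rewrite /Ptau.
rewrite (eq_bigl _ _ (@catalan_tableau n k tau)).
rewrite (eq_bigr (fun f => a ^+ k * b ^+ (n - k) *
  fillw (fun s => if s then a else b) f)); last first.
  by move=> f; rewrite -catalan_tableau; apply: wt_catalan.
by rewrite -mulr_sumr tabE -{2}(subnK kn) !exprD; ring.
Qed.
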